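(* Let $P\subset\mathbb{R}^d$ be a $d$-dimensional smooth polytope, and for $m\ge1$ write $b_m:=|\partial(mP)\cap\mathbb{Z}^d|$. (1) If $d=3$, the $f$-vector of $P$ is $(f_0,f_1,f_2)=(b_1,\;3b_1-6,\;2b_1-4)$. (2) If $d=4$, the $f$-vector of $P$ is $(f_0,f_1,f_2,f_3)=(b_1,\;b_2-b_1,\;2b_2-4b_1,\;b_2-2b_1)$. (3) If $d=5$, the $f$-vector of $P$ is $(f_0,f_1,f_2,f_3,f_4)=(b_1,\;b_2-b_1,\;4b_2-14b_1+20,\;5b_2-20b_1+30,\;2b_2-8b_1+12)$.
   Context: A lattice polytope in $\mathbb{R}^d$ is the convex hull of finitely many points of $\mathbb{Z}^d$; $mP$ is the $m$-th dilate and $\partial$ denotes boundary. A $d$-dimensional convex lattice polytope $P\subset\mathbb{R}^d$ containing the origin in its interior is called smooth if the vertices of every facet of $P$ form a $\mathbb{Z}$-basis of $\mathbb{Z}^d$. The $f$-vector of $P$ is $(f_0,f_1,\dots,f_{d-1})$, where $f_i$ is the number of $i$-dimensional faces of $P$. *)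

(* Defs.v *)
From HB Require Import structures.
From mathcomp Require Import all_boot all_order all_algebra.
From mathcomp Require Import finmap.
From mathcomp Require Import all_classical all_reals all_analysis.

Set Implicit Arguments.
Unset Strict Implicit.
Unset Printing Implicit Defensive.

Import Order.TTheory GRing.Theory Num.Theory.
Import numFieldNormedType.Exports.

Local Open Scope classical_set_scope.
Local Open Scope ring_scope.

(* R^d is 'rV[R]_d with its library topology. *)
Section Polytopes.
Variables (R : realType) (d : nat).
Implicit Types (P F V : set 'rV[R]_d) (x c : 'rV[R]_d).

Definition lattice : set 'rV[R]_d := [set x | x \is a mxOver Num.int].

Definition conv_hull (A : set 'rV[R]_d) : set 'rV[R]_d :=
  smallest (fun C => convex_set (C : set (convex_lmodType 'rV[R]_d))) A.

Definition affine_hull (A : set 'rV[R]_d) : set 'rV[R]_d :=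
  [set x | exists n (a : 'I_n -> R) (p : 'I_n -> 'rV[R]_d),
     [/\ forall i, A (p i), \sum_i a i = 1 & x = \sum_i a i *: p i]].

(* The empty set has no dimension in this sense, since its affine hull is
   empty; so the empty face is never counted in [face_num]. *)
Definition has_dim (A : set 'rV[R]_d) (k : nat) : Prop :=
  exists x (U : {vspace 'rV[R]_d}),
    \dim U = k /\ affine_hull A = [set x + u | u in [set` U]].

Definition boundary (A : set 'rV[R]_d) : set 'rV[R]_d := closure A `\` A°.

Definition dilate (m : nat) (A : set 'rV[R]_d) : set 'rV[R]_d :=
  [set m%:R *: x | x in A].

Definition lattice_polytope P : Prop :=
  exists s : seq 'rV[R]_d, [set` s] `<=` lattice /\ P = conv_hull [set` s].

Definition dotr c x : R := \sum_j c 0 j * x 0 j.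

(* The functional c = 0 is allowed, so P (and the empty set) are faces of P. *)
Definition face P F : Prop :=
  exists c (b : R), (forall x, P x -> dotr c x <= b) /\
    F = P `&` [set x | dotr c x = b].

Definition faces_of_dim P (i : nat) : set (set 'rV[R]_d) :=
  [set F | face P F /\ has_dim F i].

(* For full-dimensional P. The guard excludes d = 0, where [d.-1] is 0 rather
   than -1. *)
Definition facet P F : Prop := (0 < d)%N /\ faces_of_dim P d.-1 F.

Definition vertices P : set 'rV[R]_d := [set v | face P [set v]].

Definition lattice_basis V : Prop :=
  V `<=` lattice /\
  exists n (e : 'I_n -> 'rV[R]_d), range e = V /\
    forall z, lattice z ->
      exists! a : {ffun 'I_n -> int}, z = \sum_i e i *~ a i.

Definition smooth_polytope P : Prop :=
  [/\ lattice_polytope P, has_dim P d, P° 0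
    & forall F, facet P F -> lattice_basis (vertices F)].

(* [fset_set] sends an infinite set to the empty one. For a lattice polytope P,
   this value is never used: P has finitely many faces, and the boundary of a
   dilate is bounded. *)
Definition face_num P (i : nat) : nat := #|` fset_set (faces_of_dim P i)|.

Definition f_vector P : seq nat := [seq face_num P i | i <- iota 0 d].

Definition boundary_points P (m : nat) : nat :=
  #|` fset_set (boundary (dilate m P) `&` lattice)|.

End Polytopes.

(* Main.v *)
(* Call w the normal of the facet F when w <= 1 on P with equality exactly on F.
   By smoothness the vertices of F form a basis, with a dual basis (v_i^* ), and
   crossing the ridge of F opposite v_i replaces its normal w by
   w - t v_i^* for some t > 0, as in the simplex method.

   Fix a vector q having no zero coordinate in any of these bases, and let N(F) be
   the set of vertices of F on which q has a negative coordinate.  Then every proper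
   face G, including the empty one, lies in exactly one facet F with N(F) <= G <= F.
   Existence: take F >= G with w_F . q maximal.  Uniqueness: for two such facets,
   (w_F - w_F') . q has a forced sign, and so has its opposite.  Counting the faces
   between N(F) and F yields f_{k-1} = sum_j h_j C(d-j, d-k), with h_j the number of
   facets with |N(F)| = j; replacing q by -q replaces h_j by h_{d-j}.  Equating the
   two expressions, with f_{-1} = 1, gives the Dehn-Sommerville equations, Euler's
   relation included.

   By unimodularity, a lattice point of the boundary of mP is uniquely a positive
   integral combination, with coefficients summing to m, of the vertices of a face;
   hence b_1 = f_0 and b_2 = f_0 + f_1. *)
Require Import Defs.
From HB Require Import structures.
From mathcomp Require Import all_boot all_order all_algebra.
From mathcomp Require Import finmap.
From mathcomp Require Import all_classical all_reals all_analysis.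
From mathcomp Require Import ring lra zify.
From mathcomp Require Import fintype finset.

Set Implicit Arguments.
Unset Strict Implicit.
Unset Printing Implicit Defensive.

Import Order.TTheory GRing.Theory Num.Theory.
Import numFieldNormedType.Exports.

Local Open Scope ring_scope.

(** * Arithmetic and counting preliminaries *)

Lemma int_gt0_ge1 (R : archiRealDomainType) (a : R) : a \is a Num.int -> 0 < a -> 1 <= a.
Proof. by move=> /intrP[z ->]; rewrite ltr0z ler1z gtz0_ge1. Qed.

(** This makes the quotients [m %/ #|G|] exact when boundary points of P and 2P are counted. *)
Lemma dvdn_le2 k m : (m <= 2)%N -> (0 < k)%N -> (k <= m)%N -> (k %| m)%N.
Proof. by case: m k => [|[|[|]]] [|[|[|]]]. Qed.

Lemma card_fset_set_image (I : finType) (T : choiceType) (f : I -> T) (A : {set I}) :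
  {in A &, injective f} -> #|` fset_set [set f i | i in [set` A]]%classic| = #|A|.
Proof.
move=> finj; have -> : fset_set [set f i | i in [set` A]]%classic = [fset f i | i in A]%fset.
  have fin : finite_set [set f i | i in [set` A]]%classic.
    by apply: finite_image; exact: finite_finset.
  apply/fsetP => y; rewrite in_fset_set//; apply/idP/imfsetP => /= [/set_mem[i iA <-]|[i iA ->]].
    by exists i.
  by apply/mem_set; exists i.
by rewrite card_in_imfset//= -cardE.
Qed.

(** * Perturbing finitely many strict inequalities at once *)

Section Perturbation.
Variable R : realFieldType.

Lemma small_perturbation (I : finType) (a b : I -> R) :
  (forall i, 0 < a i) ->
  exists2 e, 0 < e & forall t i, 0 <= t <= e -> 0 < a i + t * b i.
Proof.
(* A product of factors in ]0, 1] lies below each of them and is positive even over an empty index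
   type, so it replaces a minimum. *)
move=> a0; pose e := \prod_i Num.min 1 (a i / (1 + `|b i|)).
have f0 i : 0 < Num.min 1 (a i / (1 + `|b i|)).
  by rewrite lt_min ltr01 divr_gt0// ltr_pwDl.
exists e => [|t i /andP[t0 te]]; first by apply: prodr_gt0 => i _.
have ei : e <= a i / (1 + `|b i|).
  rewrite /e (bigD1 i)//= (le_trans (ler_piMr _ _)) ?ge_min ?lexx ?orbT//.
    exact: ltW.
  by apply: prodr_ile1 => j _; rewrite ltW//= ge_min lexx.
have : t * (1 + `|b i|) <= a i.
  by rewrite -ler_pdivlMr ?(le_trans te)// ltr_pwDl.
have [->|/negPf tn0] := eqVneq t 0; first by rewrite !mul0r addr0 a0.
have {tn0} tp : 0 < t by rewrite lt_neqAle t0 eq_sym tn0.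
have := ler_norm (- b i); rewrite normrN; move: (a0 i) => {}a0; nra.
Qed.

End Perturbation.

(** * The inner product, half-spaces and generic vectors *)

Section InnerProduct.
Variables (R : realType) (d : nat).
Implicit Types (x y c : 'rV[R]_d).

Lemma dotrC x y : dotr x y = dotr y x.
Proof. by apply: eq_bigr => j _; rewrite mulrC. Qed.

Lemma dotr_is_linear c : linear (dotr c : 'rV[R]_d -> R^o).
Proof.
move=> a x y; rewrite /dotr scaler_sumr -big_split; apply: eq_bigr => j _ /=.
by rewrite !mxE mulrDr mulrCA.
Qed.

HB.instance Definition _ c :=
  GRing.isLinear.Build R 'rV[R]_d R^o _ (dotr c) (dotr_is_linear c).

Lemma dotr0r c : dotr c 0 = 0. Proof. exact: linear0. Qed.
Lemma dotrDr c x y : dotr c (x + y) = dotr c x + dotr c y.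
Proof. exact: linearD. Qed.
Lemma dotrZr c a x : dotr c (a *: x) = a * dotr c x.
Proof. exact: linearZ. Qed.
Lemma dotrNr c x : dotr c (- x) = - dotr c x. Proof. exact: linearN. Qed.
Lemma dotrBr c x y : dotr c (x - y) = dotr c x - dotr c y.
Proof. exact: linearB. Qed.
Lemma dotr0l c : dotr 0 c = 0. Proof. by rewrite dotrC dotr0r. Qed.
Lemma dotrDl c x y : dotr (x + y) c = dotr x c + dotr y c.
Proof. by rewrite dotrC dotrDr !(dotrC c). Qed.
Lemma dotrZl c a x : dotr (a *: x) c = a * dotr x c.
Proof. by rewrite dotrC dotrZr (dotrC c). Qed.
Lemma dotrNl c x : dotr (- x) c = - dotr x c.
Proof. by rewrite dotrC dotrNr (dotrC c). Qed.
Lemma dotrBl c x y : dotr (x - y) c = dotr x c - dotr y c.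
Proof. by rewrite dotrDl dotrNl. Qed.

Lemma dotr_sumr c (I : Type) (r : seq I) (p : pred I) (F : I -> 'rV[R]_d) :
  dotr c (\sum_(i <- r | p i) F i) = \sum_(i <- r | p i) dotr c (F i).
Proof. exact: linear_sum. Qed.

Lemma dotr_suml c (I : Type) (r : seq I) (p : pred I) (F : I -> 'rV[R]_d) :
  dotr (\sum_(i <- r | p i) F i) c = \sum_(i <- r | p i) dotr (F i) c.
Proof. by rewrite dotrC dotr_sumr; apply: eq_bigr => i _; rewrite dotrC. Qed.

Lemma dotr_lin_comb c n (a : 'I_n -> R) (u : 'I_n -> 'rV[R]_d) :
  dotr c (\sum_i a i *: u i) = \sum_i a i * dotr c (u i).
Proof. by rewrite dotr_sumr; apply: eq_bigr => i _; rewrite dotrZr. Qed.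

Lemma dotr_ge0 x : 0 <= dotr x x.
Proof. by apply: sumr_ge0 => j _; rewrite -expr2 sqr_ge0. Qed.

Lemma dotr_gt0 x : (0 < dotr x x) = (x != 0).
Proof.
rewrite lt_neqAle dotr_ge0 andbT eq_sym; congr (~~ _).
apply/idP/idP => [|/eqP->]; last by rewrite dotr0l.
rewrite psumr_eq0 => [/allP xx|j _]; last by rewrite -expr2 sqr_ge0.
apply/eqP/rowP => j; rewrite mxE; apply/eqP.
by have := xx j (mem_index_enum j); rewrite /= mulf_eq0 orbb.
Qed.

Lemma dotr_inj x y : (forall c, dotr x c = dotr y c) -> x = y.
Proof.
move=> xy; apply/eqP; rewrite -subr_eq0; apply: contraT; rewrite -dotr_gt0.
by rewrite dotrBl xy subrr ltxx.
Qed.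

Lemma dotr_continuous c : continuous (dotr c).
Proof.
move=> x; rewrite /dotr; elim: (index_enum _) => [|j r IH].
  by under eq_fun do rewrite big_nil; exact: cst_continuous.
under eq_fun do rewrite big_cons.
apply: continuousD IH; apply: continuousM; first exact: cst_continuous.
exact: coord_continuous.
Qed.

Lemma open_halfspace c b : open [set x | dotr c x < b]%classic.
Proof.
rewrite -[X in open X]/(dotr c @^-1` [set y | y < b])%classic.
by apply: open_comp => [x _|]; [exact: dotr_continuous|exact: open_lt].
Qed.

Lemma closed_halfspace c b : closed [set x | dotr c x <= b]%classic.
Proof.
rewrite -[X in closed X]/(dotr c @^-1` [set y | y <= b])%classic.
by apply: closed_comp => [x _|]; [exact: dotr_continuous|exact: closed_le].
Qed.

Lemma interior_segment (A : set 'rV[R]_d) x y : (A°)%classic x ->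
  exists2 e : R, 0 < e & A (x + e *: y).
Proof.
case/nbhs_ballP => r /= r0 rA.
(* Balls are boxes in the coordinates, so it suffices to keep r - e |y_j| positive for every j. *)
have [e e0 eP] := @small_perturbation R 'I_d (fun=> r) (fun j => - `|y 0 j|)
  (fun=> r0).
exists e => //; apply: rA; split=> // i j; rewrite !mxE -ball_normE/= opprD addNKr.
rewrite normrN normrM gtr0_norm// -subr_gt0 -mulrN ord1 eP//.
by rewrite lexx ltW.
Qed.

(** By induction: if the new [c] is orthogonal to [q], moving [q] slightly along [c] itself makes
    the product positive and keeps the earlier products nonzero. *)
Lemma generic_vector (s : seq 'rV[R]_d) : 0 \notin s ->
  exists q, forall c, c \in s -> dotr c q != 0.
Proof.
elim: s => [|c s IH]; first by exists 0.
rewrite inE negb_or eq_sym -dotr_gt0 => /andP[c0 /IH[q qP]].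
have [cq0|cq] := eqVneq (dotr c q) 0; last first.
  by exists q => c'; rewrite inE => /predU1P[->|/qP].
have [|e e0 eP] := @small_perturbation R 'I_(size s)
    (fun i => `|dotr s`_i q|) (fun i => - `|dotr s`_i c|).
  by move=> i; rewrite normr_gt0 qP// mem_nth.
exists (q + e *: c) => c'; rewrite inE => /predU1P[->|/(nthP 0)[i ilt <-]].
  by rewrite dotrDr cq0 add0r dotrZr gt_eqF// mulr_gt0.
have /= := eP e (Ordinal ilt); rewrite lexx ltW// => /(_ isT).
rewrite mulrN subr_gt0 dotrDr dotrZr; apply: contraTneq => /eqP.
by rewrite addr_eq0 => /eqP ->; rewrite normrN normrM gtr0_norm// ltxx.
Qed.
End InnerProduct.

(** * Facets and their normals, as index sets of tight points *)

(* [v] enumerates a set of generators of P, possibly not all of them vertices. *)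
Section Configuration.
Variables (R : realType) (d n : nat) (v : 'I_n -> 'rV[R]_d).
Implicit Types (w x y q : 'rV[R]_d) (G S : {set 'I_n}).

(** These [w] form the polar dual of the hull of the points [v i]. *)
Definition admissible w := forall i, dotr w (v i) <= 1.

Definition tight w : {set 'I_n} := [set i | dotr w (v i) == 1].

(** The second clause says that the tight points span the space, so [w] is a vertex of the polar
    dual. *)
Definition facet_normal w := admissible w /\
  forall y, (forall i, i \in tight w -> dotr y (v i) = 0) -> y = 0.

Definition facets : {set {set 'I_n}} :=
  [set S | `[< exists w, facet_normal w /\ tight w = S >]].

(** By [tight_normal] there is only one candidate when [S] is a facet; 0 is a default value for the
    other sets. *)
Definition normal S : 'rV[R]_d :=
  xget 0 [set w | facet_normal w /\ tight w = S]%classic.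

(** This is the complex generated by the facets, with the empty face in it as soon as a facet
    exists. For smooth polytopes [face_normal] shows that all its members are exposed. *)
Definition faces : {set {set 'I_n}} := [set G : {set _} | [exists S in facets, G \subset S]].

Definition faces_card k : {set {set 'I_n}} := [set G : {set _} in faces | #|G| == k].

Lemma facetsP S : S \in facets ->
  facet_normal (normal S) /\ tight (normal S) = S.
Proof.
rewrite inE => /asboolP Sw.
by rewrite /normal; case: xgetP => [w _ //|noS]; case: Sw => w /(noS w).
Qed.

Lemma tight_facets w : facet_normal w -> tight w \in facets.
Proof. by move=> wF; rewrite inE; apply/asboolP; exists w. Qed.

Lemma normal_le1 S i : S \in facets -> dotr (normal S) (v i) <= 1.
Proof. by case/facetsP => -[+ _] _; exact. Qed.

Lemma normal_eq1 S i : S \in facets -> (dotr (normal S) (v i) == 1) = (i \in S).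
Proof. by move=> /facetsP[_ {2}<-]; rewrite inE. Qed.

Lemma facet_span S y : S \in facets ->
  (forall i, i \in S -> dotr y (v i) = 0) -> y = 0.
Proof. by move=> /facetsP[[_ span] wS] yS; apply: span; rewrite wS. Qed.

Lemma tight_normal w : facet_normal w -> normal (tight w) = w.
Proof.
move=> wF; have wT := tight_facets wF; apply/eqP; rewrite -subr_eq0; apply/eqP.
apply: (facet_span wT) => i iw; rewrite dotrBl.
move: (iw); rewrite -(normal_eq1 _ wT) => /eqP ->.
by move: iw; rewrite inE => /eqP ->; rewrite subrr.
Qed.

Lemma facesP G : reflect (exists2 S, S \in facets & G \subset S) (G \in faces).
Proof. by rewrite inE; exact: exists_inP. Qed.

(* The ratio test of the simplex method. *)
Lemma pivot w y i0 : admissible w ->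
    (forall i, i \in tight w -> dotr y (v i) <= 0) -> 0 < dotr y (v i0) ->
  exists t j, [/\ 0 < t, admissible (w + t *: y), 0 < dotr y (v j)
    & j \in tight (w + t *: y)].
Proof.
move=> wA yw yi0.
pose r i := (1 - dotr w (v i)) / dotr y (v i).
have [j yj jmin] := @arg_minP _ _ _ i0 (fun i => 0 < dotr y (v i)) r yi0.
have wj : dotr w (v j) < 1.
  rewrite lt_neqAle wA andbT; apply/negP => wj1.
  by have := yw j; rewrite inE wj1 leNgt yj => /(_ isT).
exists (r j), j; split=> //; first by rewrite divr_gt0// subr_gt0.
  move=> i; rewrite dotrDl dotrZl -lerBrDl.
  have [yi|yi] := ltP 0 (dotr y (v i)); first by rewrite -ler_pdivlMr// jmin.
  apply: (@le_trans _ _ 0); last by rewrite subr_ge0 wA.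
  by rewrite mulr_ge0_le0// ltW// divr_gt0// subr_gt0.
have yj0 : dotr y (v j) != 0 by rewrite gt_eqF.
by rewrite inE dotrDl dotrZl /r divfK// addrC subrK.
Qed.

Hypothesis positively_spanning : forall y, y != 0 -> exists i, 0 < dotr y (v i).

(** Induction on the number of points that are not tight. If [w] is no facet normal, some nonzero
    [y] is orthogonal to all tight points; moving along [y] keeps them tight, and the pivot adds a
    new one. *)
Lemma extend_to_facet w : admissible w -> tight w \in faces.
Proof.
have [k] := ubnP (n - #|tight w|); elim: k w => // k IH w kw wA.
have [wF|] := pselect (facet_normal w).
  by apply/facesP; exists (tight w) => //; exact: tight_facets.
rewrite /facet_normal => /not_andP[//|/existsNP[y /not_implyP[yw /eqP y0]]].
have [i yi] := positively_spanning y0.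
have [|t [j [t0 wtA yj jt]]] := pivot wA _ yi; first by move=> l /yw ->.
have ww' : tight w \proper tight (w + t *: y).
  rewrite properE; apply/andP; split.
    by apply/subsetP => l lw; move: (lw); rewrite !inE dotrDl dotrZl (yw l lw) mulr0 addr0.
  by apply/subsetPn; exists j => //; apply: contraTN yj => /yw ->; rewrite ltxx.
have /facesP[S SF wS] : tight (w + t *: y) \in faces.
  have tn : (#|tight (w + t *: y)| <= n)%N.
    by apply: leq_trans (max_card _) _; rewrite card_ord.
  by apply: IH => //; move: kw tn (proper_card ww'); lia.
by apply/facesP; exists S => //; exact: subset_trans (proper_sub ww') wS.
Qed.

(** * Simplicial facets with dual bases, and the Dehn-Sommerville equations *)

Variable D : {set 'I_n} -> 'I_n -> 'rV[R]_d.
Hypothesis dual_basis : forall S i j, S \in facets -> i \in S -> j \in S ->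
  dotr (D S i) (v j) = (i == j)%:R.
Hypothesis card_facet : forall S, S \in facets -> #|S| = d.

Lemma dual_expand S c : S \in facets -> c = \sum_(i in S) dotr c (v i) *: D S i.
Proof.
move=> SF; apply/eqP; rewrite -subr_eq0; apply/eqP/(facet_span SF) => j jS.
rewrite dotrBl dotr_suml (bigD1 j)//= big1 => [|i /andP[iS /negPf ij]].
  by rewrite dotrZl dual_basis// eqxx mulr1 addr0 subrr.
by rewrite dotrZl dual_basis// ij mulr0.
Qed.

Lemma basis_expand S x : S \in facets -> x = \sum_(i in S) dotr (D S i) x *: v i.
Proof.
move=> SF; apply: dotr_inj => c; rewrite (dotrC x) {1}(dual_expand c SF).
rewrite dotr_suml dotr_suml; apply: eq_bigr => i _.
by rewrite !dotrZl mulrC (dotrC c).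
Qed.

(** The analogue of the restriction set of a facet in a shelling, with facets compared by the value
    of their normals at [q]. *)
Definition neg_part q S := [set i in S | dotr (D S i) q < 0].

(* Among the facets containing G, one whose normal is maximal on q works:
   otherwise a pivot would increase the value at q. *)
Lemma exists_facet_neg_part q G : G \in faces ->
  exists2 S, S \in facets & (G \subset S) && (neg_part q S \subset G).
Proof.
case/facesP => S0 S0F GS0.
have [|S /andP[SF GS] Smax] := @arg_maxP _ _ _ S0
  (fun S => (S \in facets) && (G \subset S)) (fun S => dotr (normal S) q).
  by rewrite S0F.
exists S => //; rewrite GS /=; apply: contraT => /subsetPn[i].
rewrite inE => /andP[iS qi] iG.
have [[wA _] wS] := facetsP SF.
have yj j : j \in S -> dotr (- D S i) (v j) = - (i == j)%:R.
  by move=> jS; rewrite dotrNl dual_basis.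
have [|k yk] := @positively_spanning (- D S i).
  apply/eqP => D0; have := yj i iS.
  by rewrite D0 dotr0l eqxx => /eqP; rewrite eq_sym oppr_eq0 oner_eq0.
have [|t [j [t0 wtA yj0 jt]]] := pivot wA _ yk.
  by move=> l; rewrite wS => /yj ->; rewrite oppr_le0 ler0n.
set w' := _ + _ in wtA jt.
have w'S l : l \in S -> l != i -> l \in tight w'.
  move=> lS li; rewrite inE dotrDl dotrZl yj// (eq_sym i) (negPf li) oppr0 mulr0 addr0.
  by rewrite normal_eq1.
(* A [z] orthogonal to all of [S] except [i] is a multiple of [D S i]; orthogonality to the entering
   point [j] makes the multiple zero. *)
have w'F : facet_normal w'.
  split=> // z zw'; apply: (facet_span SF) => l lS.
  have [->|li] := eqVneq l i; last exact/zw'/w'S.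
  have zE : z = dotr z (v i) *: D S i.
    rewrite [LHS](dual_expand z SF) (bigD1 i)//= big1 ?addr0// => m /andP[mS mi].
    by rewrite zw' ?scale0r// w'S.
  have /eqP := zw' j jt; rewrite {1}zE dotrZl mulf_eq0 => /predU1P[//|].
  by move=> /eqP Dj0; rewrite dotrNl Dj0 oppr0 ltxx in yj0.
have := Smax (tight w'); rewrite tight_facets//= tight_normal//.
have -> /= : G \subset tight w'.
  apply/subsetP => l lG; apply: w'S; first exact: (subsetP GS).
  by apply: contraNneq iG => <-.
by move=> /(_ isT); rewrite dotrDl dotrZl dotrNl gerDl pmulr_rle0// oppr_le0 leNgt qi.
Qed.

Definition generic q := forall S i, S \in facets -> i \in S -> dotr (D S i) q != 0.

Lemma exists_generic : exists q, generic q.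
Proof.
have [|q qP] := @generic_vector R d
    [seq D T i | T <- enum facets, i <- enum T].
  apply/negP => /allpairsPdep[S [i [+ +]]]; rewrite !mem_enum => SF iS.
  move=> /(congr1 (fun z => dotr z (v i))); rewrite dotr0l dual_basis// eqxx.
  by move/eqP; rewrite eq_sym oner_eq0.
exists q => S i SF iS; apply: qP; apply/allpairsPdep; exists S, i.
by rewrite !mem_enum.
Qed.

Lemma generic_opp q : generic q -> generic (- q).
Proof. by move=> qG S i SF iS; rewrite dotrNr oppr_eq0 qG. Qed.

Lemma neg_part_opp q S : generic q -> S \in facets ->
  neg_part (- q) S = S :\: neg_part q S.
Proof.
move=> qG SF; apply/setP => i; rewrite !inE dotrNr oppr_lt0.
case iS: (i \in S); rewrite ?andbF//= andbT -leNgt lt_neqAle eq_sym.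
by rewrite qG.
Qed.

(* The sign of [(normal S - normal S') . q] is forced both ways. *)
Lemma unique_facet_neg_part q G S S' : generic q ->
    S \in facets -> G \subset S -> neg_part q S \subset G ->
    S' \in facets -> G \subset S' -> neg_part q S' \subset G ->
  S = S'.
Proof.
move=> qG.
(* In the basis of [T], the difference of the two values is a sum of coordinates of [q] times slacks
   of [T']. Points of [T'] have slack 0; the others lie outside [G], hence outside [neg_part q T],
   and have positive coordinates. Equality therefore forces all slacks to vanish. *)
have half T T' : T \in facets -> G \subset T -> neg_part q T \subset G ->
    T' \in facets -> G \subset T' ->
    0 <= dotr (normal T - normal T') q ?= iff (T \subset T').
  move=> TF GT nT T'F GT'; set u := normal T - normal T'.
  have uE : dotr u q = \sum_(i in T) dotr (D T i) q * (1 - dotr (normal T') (v i)).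
    rewrite {1}(basis_expand q TF) dotr_sumr; apply: eq_bigr => i iT.
    move: (iT); rewrite dotrZr dotrBl.
    by rewrite -(normal_eq1 _ TF) => /eqP ->.
  have qpos i : i \in T -> i \notin T' -> 0 < dotr (D T i) q.
    move=> iT iT'; rewrite lt_neqAle eq_sym qG//= leNgt.
    apply: contra iT' => qi; apply: (subsetP GT').
    by apply: (subsetP nT); rewrite inE iT.
  have ge0 i : i \in T -> 0 <= dotr (D T i) q * (1 - dotr (normal T') (v i)).
    move=> iT; case iT' : (i \in T').
      by move: iT'; rewrite -normal_eq1// => /eqP ->; rewrite subrr mulr0.
    by rewrite mulr_ge0 ?subr_ge0 ?normal_le1// ltW// qpos// iT'.
  rewrite uE; split; first exact: sumr_ge0.
  rewrite eq_sym psumr_eq0//; apply/allP/subsetP => [TT' i iT|TT' i _].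
    have := TT' i (mem_index_enum i); rewrite iT /= mulf_eq0 (negPf (qG _ _ TF iT)).
    by rewrite subr_eq0 eq_sym normal_eq1.
  apply/implyP => /TT'; rewrite -normal_eq1// => /eqP ->.
  by rewrite subrr mulr0.
move=> SF GS nS S'F GS' nS'.
have [le1 eq1] := half _ _ SF GS nS S'F GS'.
have [le2 eq2] := half _ _ S'F GS' nS' SF GS.
have u0 : dotr (normal S - normal S') q = 0.
  apply/eqP; rewrite eq_le le1 andbT.
  by move: le2; rewrite -opprB dotrNl oppr_ge0.
apply/eqP; rewrite eqEsubset -eq1 -eq2 u0 eqxx /=.
by rewrite -opprB dotrNl u0 oppr0.
Qed.

Lemma card_facet_neg_part q G : generic q -> G \in faces ->
  #|[set S in facets | (neg_part q S \subset G) && (G \subset S)]| = 1%N.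
Proof.
move=> qG /(exists_facet_neg_part q)[S SF /andP[GS nS]].
apply/eqP/cards1P; exists S; apply/setP => S'; rewrite in_set1 in_set.
apply/idP/eqP => [/and3P[S'F nS' GS']|->]; last by rewrite SF GS nS.
exact: (@unique_facet_neg_part q G).
Qed.

(** Complements in [S] turn these sets into the subsets of [S :\: N] with d - k elements; the
    binomial is rightly 0 when [#|N|] exceeds [k]. *)
Lemma card_sets_between (N S : {set 'I_n}) k : N \subset S -> #|S| = d -> (k <= d)%N ->
  #|[set G : {set 'I_n} | [&& N \subset G, G \subset S & #|G| == k]]|
  = 'C(d - #|N|, d - k).
Proof.
move=> NS Sd kd.
have SN : #|S :\: N| = (d - #|N|)%N by rewrite cardsD (setIidPr NS) Sd.
rewrite -SN -cards_draws -[LHS](@card_in_imset _ _ (fun G => S :\: G)); last first.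
  move=> G G'; rewrite !inE => /and3P[_ GS _] /and3P[_ GS' _] /(congr1 (fun A => S :\: A)).
  by rewrite !setDDr !setDv !set0U (setIidPr GS) (setIidPr GS').
apply: eq_card => A; apply/imsetP/idP => [[G + ->]|]; rewrite !inE.
  move=> /and3P[NG GS /eqP Gk]; rewrite setDS//=.
  by rewrite cardsD (setIidPr GS) Sd Gk.
move=> /andP[ASN /eqP Ak]; exists (S :\: A).
  have AS : A \subset S by rewrite (subset_trans ASN)// subsetDl.
  rewrite !inE subsetDl/= cardsD (setIidPr AS) Sd Ak subKn// eqxx andbT.
  rewrite subsetD NS disjoint_sym; move: ASN; rewrite subsetD => /andP[_ //].
rewrite setDDr setDv set0U (setIidPr _)//.
by rewrite (subset_trans ASN)// subsetDl.
Qed.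

Lemma neg_part_sub q S : neg_part q S \subset S.
Proof. by apply/subsetP => i; rewrite inE => /andP[]. Qed.

Lemma card_neg_part q S : S \in facets -> (#|neg_part q S| <= d)%N.
Proof. by move=> SF; rewrite -(card_facet SF) subset_leq_card// neg_part_sub. Qed.

(** Double counting: each face is replaced by a sum over its single compatible facet, and the sums
    are exchanged. *)
Lemma card_faces_neg_part q k : generic q -> (k <= d)%N ->
  #|faces_card k| = (\sum_(S in facets) 'C(d - #|neg_part q S|, d - k))%N.
Proof.
move=> qG kd.
transitivity (\sum_(G in faces_card k) \sum_(S in facets |
    (neg_part q S \subset G) && (G \subset S)) 1)%N.
  rewrite -sum1_card; apply: eq_bigr => G; rewrite inE => /andP[GF _].
  by rewrite -[LHS](card_facet_neg_part qG GF) -sum1_card; apply: eq_bigl => S; rewrite !inE.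
rewrite (exchange_big_dep [in facets])/=; last by move=> G S _ /andP[].
apply: eq_bigr => S SF.
rewrite sum1_card -(card_sets_between (neg_part_sub q S) (card_facet SF) kd).
apply: eq_card => G; rewrite unfold_in /= SF /= !in_set /=.
case nG: (neg_part q S \subset G); rewrite /= ?andbF//.
case GS: (G \subset S); rewrite /= ?andbF// andbT; apply: andb_idl => _.
by apply/exists_inP; exists S.
Qed.

(** Both formulas use the [h] of one generic [q]: the first is the count made with [- q], the second
    the count made with [q]. *)
Lemma dehn_sommerville : exists h : nat -> nat, forall k, (k <= d)%N ->
  #|faces_card k| = (\sum_(p < d.+1) h p * 'C(p, d - k))%N /\
  #|faces_card k| = (\sum_(p < d.+1) h p * 'C(d - p, d - k))%N.
Proof.
have [q qG] := exists_generic.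
have sumE (F : nat -> nat) : (\sum_(S in facets) F #|neg_part q S|)%N =
    (\sum_(p < d.+1) #|[set S in facets | #|neg_part q S| == p]| * F p)%N.
  (* Facets are grouped by the size of their negative part; [inord] is faithful because this size is
     at most [d]. *)
  rewrite (partition_big (fun S => inord #|neg_part q S| : 'I_d.+1) predT)//=.
  apply: eq_bigr => p _; rewrite -sum1_card big_distrl/=.
  rewrite [RHS](eq_bigl (fun S => (S \in facets) && (inord #|neg_part q S| == p))).
    apply: eq_bigr => S /andP[SF /eqP <-].
    by rewrite mul1n inordK// ltnS card_neg_part.
  move=> S; rewrite inE; apply: andb_id2l => SF.
  by rewrite -val_eqE/= inordK// ltnS card_neg_part.
exists (fun p => #|[set S in facets | #|neg_part q S| == p]|) => k kd; split.
  rewrite (card_faces_neg_part (generic_opp qG) kd) -(sumE (fun p => 'C(p, d - k))).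
  apply: eq_bigr => S SF; rewrite neg_part_opp// cardsD (setIidPr (neg_part_sub q S)).
  by rewrite card_facet// subKn// card_neg_part.
by rewrite (card_faces_neg_part qG kd) -(sumE (fun p => 'C(d - p, d - k))).
Qed.

(** The normalisation f_{-1} = 1: extending the admissible functional 0 shows that a facet exists,
    so the empty set is a face. *)
Lemma card_faces0 : #|faces_card 0| = 1%N.
Proof.
apply/eqP/cards1P; exists set0; apply/setP => G.
rewrite !inE cards_eq0; apply: andb_idl => /eqP ->.
have /facesP[S SF _] : tight 0 \in faces.
  by apply: extend_to_facet => i; rewrite dotr0l ler01.
by apply/exists_inP; exists S => //; exact: sub0set.
Qed.

End Configuration.

(** * Convex hulls, exposed faces and dimension *)

Section Hull.
Variables (R : realType) (d n : nat) (v : 'I_n -> 'rV[R]_d).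
Implicit Types (w x y c : 'rV[R]_d) (G S : {set 'I_n}).

(** Coefficients live on all of ['I_n] and vanish off [S], so that hulls of different subsets share
    one index type. *)
Definition hull S : set 'rV[R]_d := [set x | exists a : 'I_n -> R,
  [/\ forall i, 0 <= a i, forall i, i \notin S -> a i = 0, \sum_i a i = 1
    & x = \sum_i a i *: v i]]%classic.

Lemma hull_vertex S i : i \in S -> hull S (v i).
Proof.
move=> iS; exists (fun j => (j == i)%:R); split=> [j|j jS||]; first exact: ler0n.
- by case: eqVneq jS => // ->; rewrite iS.
- by rewrite (bigD1 i)//= eqxx big1 ?addr0// => j /negPf ->.
- by rewrite (bigD1 i)//= eqxx scale1r big1 ?addr0// => j /negPf ->; rewrite scale0r.
Qed.

Lemma convex_lin_comb (C : set 'rV[R]_d) (r : seq 'I_n) (a : 'I_n -> R) :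
    convex_set (C : set (convex_lmodType 'rV[R]_d)) ->
    (forall i, C (v i)) -> (forall i, 0 <= a i) -> \sum_(i <- r) a i = 1 ->
  C (\sum_(i <- r) a i *: v i).
Proof.
move=> cC vC; elim: r a => [|i r IH] a a0.
  by rewrite big_nil => /eqP; rewrite eq_sym oner_eq0.
rewrite !big_cons; set s := \sum_(j <- r) a j => as1.
have s0 : 0 <= s by exact: sumr_ge0.
have ai1 : a i <= 1 by rewrite -as1 lerDl.
(* The tail is rescaled by its total weight; if that weight is 0, all its terms vanish. *)
have [sz|sn0] := eqVneq s 0.
  rewrite big_seq big1 ?addr0; last first.
    move=> j jr; suff /eqP -> : a j == 0 by rewrite scale0r.
    move/eqP: sz; rewrite psumr_eq0// => /allP/(_ j jr)/implyP; exact.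
  by move: as1; rewrite sz addr0 => ->; rewrite scale1r.
have Cy : C (\sum_(j <- r) (a j / s) *: v j).
  by apply: IH => [j|]; rewrite ?divr_ge0// -mulr_suml divff.
have Cxy : C (a i *: v i + (1 - a i) *: \sum_(j <- r) (a j / s) *: v j).
  exact: set_mem (cC _ _ (Itv01 (a0 i) ai1) (mem_set (vC i)) (mem_set Cy)).
congr C: Cxy; congr (_ + _); rewrite -as1 addrC addKr scaler_sumr.
by apply: eq_bigr => j _; rewrite scalerA mulrC divfK.
Qed.

Lemma conv_hull_range : conv_hull (range v) = hull [set: 'I_n].
Proof.
apply/seteqP; split.
  apply: smallest_sub; last by move=> _ [i _ <-]; apply: hull_vertex; rewrite inE.
  move=> x y k /set_mem[a [a0 _ a1 ->]] /set_mem[b [b0 _ b1 ->]]; apply/mem_set.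
  exists (fun i => k%:num * a i + (1 - k%:num) * b i); split=> [i|i||].
  - by rewrite addr_ge0 ?mulr_ge0// subr_ge0.
  - by rewrite inE.
  - by rewrite big_split/= -!mulr_sumr a1 b1 !mulr1 addrC subrK.
  - transitivity (k%:num *: (\sum_i a i *: v i) + (1 - k%:num) *: \sum_i b i *: v i) => //.
    rewrite !scaler_sumr -big_split/=.
    by apply: eq_bigr => i _; rewrite !scalerA -scalerDl.
move=> _ [a [a0 _ a1 ->]] C [cC vC]; apply: convex_lin_comb => // i.
by apply: vC; exists i.
Qed.

Lemma hull_le c b S x : (forall i, i \in S -> dotr c (v i) <= b) ->
  hull S x -> dotr c x <= b.
Proof.
move=> cb [a [a0 aS a1 ->]]; rewrite dotr_lin_comb -[b]mul1r -a1 mulr_suml.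
apply: ler_sum => i _; case iS: (i \in S); first by rewrite ler_wpM2l// cb.
by rewrite aS ?iS// !mul0r.
Qed.

(** Complementary slackness: the products [a i * (b - dotr c (v i))] are nonnegative and sum to
    0. *)
Lemma hull_eq c b S a : (forall i, i \in S -> dotr c (v i) <= b) ->
    (forall i, 0 <= a i) -> (forall i, i \notin S -> a i = 0) -> \sum_i a i = 1 ->
    dotr c (\sum_i a i *: v i) = b ->
  forall i, dotr c (v i) != b -> a i = 0.
Proof.
move=> cb a0 aS a1 ab i ci; have [iS|] := boolP (i \in S); last exact: aS.
have ge0 j : true -> 0 <= a j * (b - dotr c (v j)).
  move=> _; case jS: (j \in S); last by rewrite aS ?jS// mul0r.
  by rewrite mulr_ge0// subr_ge0 cb.
have /psumr_eq0P : \sum_j a j * (b - dotr c (v j)) = 0.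
  under eq_bigr do rewrite mulrBr; rewrite sumrB -mulr_suml a1 mul1r.
  by rewrite -dotr_lin_comb ab subrr.
move=> /(_ ge0 i isT)/eqP; rewrite mulf_eq0 => /predU1P[//|].
by rewrite subr_eq0 eq_sym (negPf ci).
Qed.

Lemma hull_tight w : admissible v w ->
  (hull [set: 'I_n] `&` [set x | dotr w x = 1])%classic = hull (tight v w).
Proof.
move=> wA; apply/seteqP; split=> [_ [[a [a0 _ a1 ->]] /= wx]|x].
  exists a; split=> // i; rewrite inE.
  by apply: (@hull_eq w 1 [set: 'I_n]) => // j; rewrite inE.
move=> xT; split.
  by case: xT => a [a0 aT a1 ->]; exists a; split=> // i; rewrite inE.
apply/eqP; rewrite eq_le (@hull_le w 1 [set: 'I_n])//=; last first.
  by case: xT => a [a0 aT a1 ->]; exists a; split=> // i; rewrite inE.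
rewrite -lerN2 -dotrNl; apply: hull_le xT => i; rewrite inE => /eqP wi.
by rewrite dotrNl wi.
Qed.

(* Ties for the maximum of [c] are broken by the Euclidean norm: a point of
   largest norm in a finite set is exposed in it by the functional it defines. *)
Lemma exposed_maximizer c S i0 : i0 \in S -> exists2 k, k \in S &
  (forall i, i \in S -> dotr c (v i) <= dotr c (v k)) /\ face (hull S) [set v k]%classic.
Proof.
move=> i0S.
have [m mS mmax] := @arg_maxP _ _ _ i0 (mem S) (fun i => dotr c (v i)) i0S.
have [|k /andP[kS /eqP km] kmax] := @arg_maxP _ _ _ m
  (fun i => (i \in S) && (dotr c (v i) == dotr c (v m))) (fun i => dotr (v i) (v i)).
  by rewrite eqxx andbT; exact: mS.
have cmax i : i \in S -> dotr c (v i) <= dotr c (v k) by rewrite km; exact: mmax.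
exists k => //; split=> //.
(* On ties the true gap is 0, while [small_perturbation] wants positive numbers; 1 is a placeholder
   there, and ties are settled by the norms below. *)
pose gap i := if dotr c (v i) < dotr c (v k) then dotr c (v k) - dotr c (v i) else 1.
have [|e e0 eP] := @small_perturbation R 'I_n gap
    (fun i => dotr (v k) (v k) - dotr (v k) (v i)).
  by move=> i; rewrite /gap; case: ifPn => //; rewrite subr_gt0.
pose c' := c + e *: v k.
have c'lt i : i \in S -> v i != v k -> dotr c' (v i) < dotr c' (v k).
  move=> iS ik; rewrite !dotrDl !dotrZl -subr_gt0.
  have := eP e i; rewrite lexx ltW//= => /(_ isT); rewrite /gap.
  have := cmax i iS; rewrite le_eqVlt; case: ltP => [_ _|_ /orP[/eqP ci|//]].
    by congr (0 < _); rewrite mulrBr; ring.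
  move=> _; rewrite ci opprD addrACA subrr add0r -mulrBr pmulr_rgt0//.
  have /= := kmax i; rewrite iS ci km eqxx => /(_ isT).
  (* Expanded, and combined with |v i|^2 <= |v k|^2, this gives v k . v i < v k . v k. *)
  have : 0 < dotr (v i - v k) (v i - v k) by rewrite dotr_gt0 subr_eq0.
  by rewrite dotrBl !dotrBr (dotrC (v i) (v k)); lra.
have c'le i : i \in S -> dotr c' (v i) <= dotr c' (v k).
  by move=> iS; have [->//|/(c'lt i iS)/ltW] := eqVneq (v i) (v k).
exists c', (dotr c' (v k)); split; first by move=> x; exact: hull_le.
apply/seteqP; split=> [_ ->|_ [[a [a0 aS a1 ->]] /= c'x]].
  by split=> //; exact: hull_vertex.
rewrite -[RHS]scale1r -a1 scaler_suml; apply: eq_bigr => i _.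
have [->//|ik] := eqVneq (v i) (v k); case iS: (i \in S); last first.
  by rewrite aS ?iS// !scale0r.
have -> : a i = 0; last by rewrite !scale0r.
by apply: (hull_eq c'le a0 aS a1 c'x); rewrite lt_eqF// c'lt.
Qed.

(** If no generator reached the bound [b], complementary slackness would make all coefficients of
    [y] vanish, although they sum to 1. *)
Lemma face_singleton S y : face (hull S) [set y]%classic -> exists2 i, i \in S & y = v i.
Proof.
move=> [c [b [cb yE]]].
have [yS yb] : (hull S `&` [set x | dotr c x = b])%classic y by rewrite -yE.
have [/existsP[i /andP[iS /eqP ci]]|] := boolP [exists i, (i \in S) && (dotr c (v i) == b)].
  exists i => //; suff : [set y]%classic (v i) by [].
  by rewrite yE; split=> //; exact: hull_vertex.
rewrite negb_exists => /forallP nS; exfalso.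
case: yS yb => a [a0 aS a1 ->] yb.
have az i : a i = 0.
  case iS: (i \in S); last by rewrite aS ?iS.
  apply: (@hull_eq c b S a) => // [j jS|]; first exact/cb/hull_vertex.
  by have := nS i; rewrite iS.
by move/eqP: a1; rewrite big1// eq_sym oner_eq0.
Qed.

Lemma has_dim_inj (A : set 'rV[R]_d) k l : has_dim A k -> has_dim A l -> k = l.
Proof.
wlog: k l / (k <= l)%N => [wlg kA lA|kl].
  by case: (leqP k l) => [|/ltnW] kl; [|apply/esym]; exact: wlg.
move=> [x [U [<- AU]]] [y [W [Wl AW]]]; apply/eqP; rewrite eqn_leq -{1}Wl.
have sub (x' y' : 'rV[R]_d) (U' W' : {vspace 'rV[R]_d}) :
    [set x' + u | u in [set` U']]%classic = [set y' + u | u in [set` W']]%classic ->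
    (\dim U' <= \dim W')%N.
  move=> UW; apply: dimvS; apply/subvP => u uU.
  have [w0 w0W w0E] : [set y' + u | u in [set` W']]%classic x'.
    by rewrite -UW; exists 0; rewrite ?addr0//=; exact: mem0v.
  have [w1 w1W w1E] : [set y' + u | u in [set` W']]%classic (x' + u).
    by rewrite -UW; exists u.
  have -> : u = w1 - w0.
    by apply: (addrI x'); rewrite -w1E -w0E -addrA (addrCA w0) subrr addr0.
  exact: memvB.
by rewrite (sub x y)// -?AU//= -Wl (sub y x)// -AW.
Qed.

Lemma has_dim_neq0 (A : set 'rV[R]_d) k : has_dim A k -> exists x, A x.
Proof.
move=> [x [U [_ AU]]].
have [m [a [p [pA a1 _]]]] : affine_hull A x.
  by rewrite AU; exists 0; rewrite ?addr0//=; exact: mem0v.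
case: m a p pA a1 => [a p _ /eqP|m a p pA _]; last by exists (p ord0).
by rewrite big_ord0 eq_sym oner_eq0.
Qed.

Definition vspan S : {vspace 'rV[R]_d} := (\sum_(i in S) <[v i]>)%VS.

Lemma vspanP S x :
  reflect (exists a : 'I_n -> R, x = \sum_(i in S) a i *: v i) (x \in vspan S).
Proof.
apply: (iffP memv_sumP) => [[u uS ->]|[a ->]]; last first.
  by exists (fun i => a i *: v i) => // i _; rewrite memvZ// memv_line.
have /choice[a aP] i : exists a, i \in S -> u i = a *: v i.
  by case iS: (i \in S); [have /vlineP[a ->] := uS i iS; exists a|exists 0].
by exists a; apply: eq_bigr.
Qed.

Lemma hull_vspan S x : hull S x -> x \in vspan S.
Proof.
move=> [a [_ aS _ ->]]; apply/vspanP; exists a.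
rewrite [LHS](bigID [in S])/= [X in _ + X]big1 ?addr0// => i iS.
by rewrite aS ?scale0r.
Qed.

(** The hull lies in the hyperplane w . x = 1, which misses 0; its affine hull thus has one
    dimension less than its linear span. *)
Lemma has_dim_hull S w i0 : i0 \in S -> (forall i, i \in S -> dotr w (v i) = 1) ->
  has_dim (hull S) (\dim (vspan S)).-1.
Proof.
move=> i0S wS; pose f := linfun (dotr w : 'rV[R]_d -> R^o).
have wh x : hull S x -> dotr w x = 1.
  move=> xS; apply/eqP; rewrite eq_le (hull_le _ xS) => [|i /wS ->//].
  rewrite -lerN2 -dotrNl (hull_le _ xS)// => i /wS wi.
  by rewrite dotrNl wi.
have i0V : v i0 \in vspan S by exact/hull_vspan/hull_vertex.
exists (v i0), (vspan S :&: lker f)%VS; split.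
  rewrite -(limg_ker_dim f (vspan S)); suff -> : \dim (f @: vspan S) = 1%N.
    by rewrite addn1.
  apply/eqP; rewrite eqn_leq lt0n dimv_eq0 (leq_trans (dimvS (subvf _))) ?dimvf//=.
  apply: contraTneq (memv_img f i0V) => ->.
  by rewrite lfunE/= wS// memv0 oner_eq0.
apply/seteqP; split=> [_ [m [a [p [pS a1 ->]]]]|_ [u /= uU <-]].
  exists (\sum_i a i *: p i - v i0); last by rewrite addrC subrK.
  rewrite /= memv_cap memvB//= ?memv_suml// => [|i _]; last exact/memvZ/hull_vspan.
  rewrite memv_ker lfunE/= dotrBr dotr_lin_comb wS//.
  by under eq_bigr do rewrite wh// mulr1; rewrite a1 subrr.
move: uU; rewrite memv_cap memv_ker lfunE/= => /andP[/vspanP[a ->] /eqP].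
rewrite dotr_sumr => wa.
(* The extra weight 1 at [i0] is the base point. Every listed point must lie in the hull, so indices
   outside [S] get the dummy point [v i0] with weight 0. *)
exists n, (fun i => (if i \in S then a i else 0) + (i == i0)%:R),
  (fun i => if i \in S then v i else v i0); split.
- by move=> i; case: ifPn => [iS|_]; exact: hull_vertex.
- rewrite big_split/= [X in _ + X](bigD1 i0)//= eqxx [X in _ + (_ + X)]big1 ?addr0; last first.
    by move=> i /negPf ->.
  rewrite -big_mkcond/= -[RHS]add0r -[in RHS]wa; congr (_ + _); apply: eq_bigr => i iS.
  by rewrite dotrZr wS ?mulr1.
under [RHS]eq_bigr do rewrite scalerDl.
rewrite big_split/= [X in _ = _ + X](bigD1 i0)//= i0S eqxx scale1r [LHS]addrC.
rewrite [X in _ = _ + (_ + X)]big1 ?addr0 => [|i /negPf ->]; last by rewrite scale0r.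
rewrite big_mkcond; congr (_ + _); apply: eq_bigr => i _.
by case: ifP => // _; rewrite scale0r.
Qed.

(** The matrix whose rows are the points of [S], padded with zero rows, has full rank because its
    transpose has trivial left kernel. *)
Lemma dim_vspan_full S :
  (forall y, (forall i, i \in S -> dotr y (v i) = 0) -> y = 0) -> \dim (vspan S) = d.
Proof.
move=> spanS; pose M := \matrix_(i < n) (if i \in S then v i else 0).
have MT : row_free M^T.
  rewrite -kermx_eq0; apply/rowV0P => y /sub_kermxP yM; apply: spanS => i iS.
  have := congr1 (fun A : 'rV[R]_n => A 0 i) yM; rewrite !mxE => <-.
  by apply: eq_bigr => j _; rewrite !mxE iS.
have Mfull : row_full M by rewrite /row_full -mxrank_tr.
suff -> : vspan S = fullv by rewrite dimvf /dim /= mul1n.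
apply/eqP; rewrite eqEsubv subvf; apply/subvP => x _.
have /submxP[a ->] := submx_full x Mfull; apply/vspanP; exists (a 0).
rewrite mulmx_sum_row [RHS]big_mkcond; apply: eq_bigr => i _; rewrite rowK.
by case: ifP => // _; rewrite scaler0.
Qed.

Lemma dim_vspan_free S (c : 'I_n -> 'rV[R]_d) :
  (forall i j, i \in S -> j \in S -> dotr (c i) (v j) = (i == j)%:R) ->
  \dim (vspan S) = #|S|.
Proof.
move=> cv.
have /directvP/= -> : directv (\sum_(i in S) <[v i]>)%VS.
  apply/directv_sum_independent => u uv u0 i iS.
  have [a ua] := vlineP _ _ (uv i iS).
  have := congr1 (dotr (c i)) u0; rewrite dotr0r dotr_sumr (bigD1 i)//= big1.
    by rewrite ua dotrZr cv// eqxx mulr1 addr0 => ->; rewrite scale0r.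
  move=> j /andP[jS ji]; have [b ->] := vlineP _ _ (uv j jS).
  by rewrite dotrZr cv// eq_sym (negPf ji) mulr0.
rewrite -sum1_card; apply: eq_bigr => i iS; rewrite dim_vline.
suff -> : v i != 0 by [].
by apply/eqP => vi0; have := cv i i iS iS; rewrite vi0 dotr0r eqxx => /esym/eqP; rewrite oner_eq0.
Qed.

End Hull.

(** * Smooth polytopes: dual lattice bases and the face complex *)

Section Smooth.
Variables (R : realType) (d : nat).

(** Let the rows of E be the basis, of size [m] not known yet. Integral expansions of the unit
    vectors give A with A E = 1; uniqueness of the expansion of each basis vector gives E A = 1.
    Hence m = d, and the columns of the integral matrix A are the dual basis. *)
Lemma lattice_basis_dual (V : set 'rV[R]_d) : lattice_basis V ->
  exists (e c : 'I_d -> 'rV[R]_d),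
  [/\ range e = V, forall i j, dotr (c i) (e j) = (i == j)%:R,
    forall i z, lattice z -> dotr (c i) z \is a Num.int &
    forall x, x = \sum_i dotr (c i) x *: e i].
Proof.
move=> [Vlat [m [e [eV ebasis]]]].
have elat i : lattice (e i) by apply: Vlat; rewrite -eV; exists i.
have /choice[a aP] (j : 'I_d) : exists a : {ffun 'I_m -> int},
    delta_mx 0 j = \sum_i e i *~ a i :> 'rV[R]_d.
  have [|a [aE _]] := ebasis (delta_mx 0 j); last by exists a.
  by apply/mxOverP => k l; rewrite mxE natr_int.
pose E : 'M[R]_(m, d) := \matrix_i e i.
pose A : 'M[R]_(d, m) := \matrix_(j, i) (a j i)%:~R.
have AE : A *m E = 1%:M.
  apply/row_matrixP => j; rewrite row1 aP row_mul mulmx_sum_row.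
  by apply: eq_bigr => i _; rewrite !mxE rowK scaler_int.
have EA : E *m A = 1%:M.
  have EAint i k : (E *m A) i k \is a Num.int.
    rewrite !mxE rpred_sum// => j _; rewrite !mxE rpredM ?intr_int//.
    by have /mxOverP/(_ 0 j) := elat i.
  have uniq i (b b' : 'I_m -> int) :
      e i = \sum_k e k *~ b k -> e i = \sum_k e k *~ b' k -> b =1 b'.
    move=> bE b'E k; have [c [_ cU]] := ebasis _ (elat i).
    have cb (f : 'I_m -> int) : e i = \sum_k e k *~ f k -> c = [ffun k => f k].
      by move=> fE; apply: cU; rewrite [LHS]fE; apply: eq_bigr => l _; rewrite ffunE.
    have /ffunP/(_ k) : [ffun k => b k] = [ffun k => b' k] by rewrite -cb// -cb.
    by rewrite !ffunE.
  apply/matrixP => i k; rewrite [RHS]mxE.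
  have EAk : e i = \sum_l e l *~ Num.floor ((E *m A) i l).
    have -> : e i = row i (E *m A *m E) by rewrite -mulmxA AE mulmx1 rowK.
    rewrite row_mul mulmx_sum_row; apply: eq_bigr => l _.
    by rewrite [row i _ 0 l]mxE -[in LHS](floorK (EAint i l)) scaler_int rowK.
  have ek : e i = \sum_l e l *~ (i == l)%:R.
    rewrite (bigD1 i)//= eqxx big1 ?addr0// => l li.
    by rewrite eq_sym (negPf li).
  by rewrite -(floorK (EAint i k)) (uniq i _ _ EAk ek k); case: eqP.
have md : m = d by apply/eqP; rewrite eqn_leq (mulmx1_min EA) (mulmx1_min AE).
subst m; exists e, (fun i => (col i A)^T); split=> // [i j|i z zlat|x].
  have := congr1 (fun M : 'M[R]_d => M j i) EA; rewrite !mxE eq_sym => <-.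
  by apply: eq_bigr => k _; rewrite !mxE mulrC.
  rewrite rpred_sum// => k _; rewrite !mxE rpredM ?intr_int//.
  by have /mxOverP := zlat.
rewrite -[LHS]mulmx1 -AE mulmxA mulmx_sum_row; apply: eq_bigr => i _; rewrite rowK.
by congr (_ *: _); rewrite !mxE /dotr; apply: eq_bigr => k _; rewrite !mxE mulrC.
Qed.

Variables (n : nat) (v : 'I_n -> 'rV[R]_d).
Hypothesis v_inj : injective v.
Hypothesis v_lattice : forall i, lattice (v i).
Hypothesis d_gt0 : (0 < d)%N.
Local Notation P := (hull v [set: 'I_n]).
Hypothesis P_dim : has_dim P d.
Hypothesis P_int0 : (P° 0)%classic.
Hypothesis P_facets : forall F, facet P F -> lattice_basis (vertices F).

Implicit Types (G S : {set 'I_n}) (x y w c : 'rV[R]_d).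

Lemma positively_spanning_of_interior y : y != 0 -> exists i, 0 < dotr y (v i).
Proof.
move=> y0; have [/existsP//|] := boolP [exists i, 0 < dotr y (v i)].
rewrite negb_exists => /forallP yv; exfalso.
have [e e0 ye] := interior_segment y P_int0.
have : dotr y (0 + e *: y) <= 0.
  by apply: hull_le ye => i _; rewrite leNgt.
by rewrite add0r dotrZr leNgt mulr_gt0// dotr_gt0.
Qed.
Let pos_span := positively_spanning_of_interior.

Lemma facet_nonempty S : S \in facets v -> exists i, i \in S.
Proof.
move=> SF; apply/set0Pn; apply: contraTneq d_gt0 => S0.
rewrite -leqNgt leqn0 -(@dim_vspan_full _ _ _ v S) => [|y]; last exact: facet_span.
by rewrite /vspan S0 big_set0 dimv0.
Qed.

Lemma facet_hull S : S \in facets v -> facet P (hull v S).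
Proof.
move=> SF; have [[wA wspan] wS] := facetsP SF; split=> //; split.
  exists (normal v S), 1; split; last by rewrite hull_tight// wS.
  by move=> x; apply: hull_le => i _; exact: wA.
have [i iS] := facet_nonempty SF.
rewrite -[d in d.-1](@dim_vspan_full _ _ _ v S) => [|y]; last exact: facet_span.
by apply: (has_dim_hull (w := normal v S) iS) => j; rewrite -(normal_eq1 _ SF) => /eqP.
Qed.

(** Smoothness speaks of vertices, while [S] indexes all generators on the facet. A generator has
    integral coordinates in the vertex basis. They are nonnegative, because each dual functional
    attains its minimum over [S] at a vertex, that is, at a basis vector. They sum to 1, because the
    facet normal is 1 on the basis. So one coordinate is 1 and the others are 0. *)
Lemma vertices_facet S : S \in facets v -> vertices (hull v S) = [set v i | i in [set` S]]%classic.
Proof.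
move=> SF; apply/seteqP; split=> [y /face_singleton[i iS ->]|_ [i /= iS <-]]; first by exists i.
have [e [c [eV ce clat cE]]] := lattice_basis_dual (P_facets (facet_hull SF)).
pose a k := dotr (c k) (v i).
have eS k : exists2 j, j \in S & e k = v j.
  have : vertices (hull v S) (e k) by rewrite -eV; exists k.
  exact: face_singleton.
have a0 k : 0 <= a k.
  have [j jS [jmax jface]] := exposed_maximizer v (- c k) iS.
  have [l _ lj] : range e (v j) by rewrite eV.
  rewrite -oppr_le0 -dotrNl (le_trans (jmax i iS))// -lj dotrNl ce.
  by rewrite oppr_le0 ler0n.
have a_int k : a k \is a Num.int by apply: clat.
have a1 : \sum_k a k = 1.
  have /eqP <- : dotr (normal v S) (v i) == 1 by rewrite normal_eq1.
  rewrite (cE (v i)) dotr_sumr; apply: eq_bigr => k _.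
  have [j jS ->] := eS k; move: jS; rewrite dotrZr -(normal_eq1 _ SF) => /eqP ->.
  by rewrite mulr1.
have [k ak0] : exists k, a k != 0.
  have [/existsP//|] := boolP [exists k, a k != 0].
  rewrite negb_exists => /forallP az; move/eqP: a1; rewrite big1 ?(eq_sym 0) ?oner_eq0//.
  by move=> k _; apply/eqP; rewrite -[_ == _]negbK az.
have ak1 : 1 <= a k by rewrite int_gt0_ge1// lt_neqAle eq_sym ak0 a0.
have rest : \sum_(l | l != k) a l = 0.
  apply/eqP; rewrite eq_le sumr_ge0 ?andbT => [|//].
  by move: a1; rewrite (bigD1 k)//=; move: ak1; lra.
rewrite -eV; exists k => //; rewrite (cE (v i)) (bigD1 k)//= -/(a k) big1 ?addr0.
  by move: a1; rewrite (bigD1 k)//= rest addr0 => ->; rewrite scale1r.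
move=> l lk; rewrite -/(a l) (psumr_eq0P _ rest lk) ?scale0r//.
Qed.

(** The dual bases are reindexed by generators, which injectivity of [v] permits. Their integrality
    on the lattice is what unimodularity contributes to the count of lattice points. *)
Lemma facet_dual_basis : exists D : {set 'I_n} -> 'I_n -> 'rV[R]_d,
  (forall S i j, S \in facets v -> i \in S -> j \in S ->
    dotr (D S i) (v j) = (i == j)%:R) /\
  (forall S i z, S \in facets v -> i \in S -> lattice z ->
    dotr (D S i) z \is a Num.int).
Proof.
suff /choice[D Dp] (Si : {set 'I_n} * 'I_n) : exists c, Si.1 \in facets v -> Si.2 \in Si.1 ->
    (forall j, j \in Si.1 -> dotr c (v j) = (Si.2 == j)%:R) /\
    (forall z, lattice z -> dotr c z \is a Num.int).
  exists (fun S i => D (S, i)); split=> S i.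
    by move=> j SF iS jS; case: (Dp (S, i) SF iS) => + _; exact.
  by move=> z SF iS zl; case: (Dp (S, i) SF iS) => _; exact.
case: Si => S i /=; have [SF|] := boolP (S \in facets v); last by exists 0.
have [iS|] := boolP (i \in S); last by exists 0.
have [e [c [eV ce clat cE]]] := lattice_basis_dual (P_facets (facet_hull SF)).
rewrite vertices_facet// in eV.
have [k _ ki] : range e (v i) by rewrite eV; exists i.
exists (c k) => _ _; split=> [j jS|z]; last exact: clat.
have [l _ lj] : range e (v j) by rewrite eV; exists j.
rewrite -lj ce; congr ((nat_of_bool _)%:R); apply/eqP/eqP => [kl|ij].
  by apply: v_inj; rewrite -ki -lj kl.
have := ce k l; rewrite lj -ij -ki ce eqxx => /eqP; rewrite eqr_nat.
by case: (eqVneq k l).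
Qed.

Lemma card_facet_smooth S : S \in facets v -> #|S| = d.
Proof.
move=> SF; have [D [Dv _]] := facet_dual_basis.
rewrite -(dim_vspan_free (v := v) (c := D S)); last by move=> i j; exact: Dv.
by apply: dim_vspan_full => y; exact: facet_span.
Qed.

Variable D : {set 'I_n} -> 'I_n -> 'rV[R]_d.
Hypothesis dual_basis : forall S i j, S \in facets v -> i \in S -> j \in S ->
  dotr (D S i) (v j) = (i == j)%:R.
Hypothesis D_int : forall S i z, S \in facets v -> i \in S -> lattice z ->
  dotr (D S i) z \is a Num.int.

(** Subtracting from the normal of [S] a small multiple of the dual vectors of [S :\: G] loosens
    exactly these points of [S]; generators outside [S] have positive slack and keep it. *)
Lemma face_normal G : G \in faces v -> exists2 w, admissible v w & tight v w = G.
Proof.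
case/facesP => S SF GS; pose z := \sum_(k in S :\: G) D S k.
have [|e e0 eP] := @small_perturbation R 'I_n
    (fun j => if j \in S then 1 else 1 - dotr (normal v S) (v j))
    (fun j => dotr z (v j)).
  move=> j; case: ifPn => // jS; rewrite subr_gt0 lt_neqAle normal_le1// andbT.
  by rewrite normal_eq1.
have zS j : j \in S -> dotr z (v j) = (j \notin G)%:R.
  move=> jS; rewrite dotr_suml; have [jG|jG] := boolP (j \in G).
    rewrite big1// => k; rewrite inE => /andP[kG kS]; rewrite dual_basis//.
    by case: eqVneq kG => // ->; rewrite jG.
  rewrite (bigD1 j) ?inE ?jG//= dual_basis// eqxx big1 ?addr0// => k.
  by rewrite inE => /andP[/andP[_ kS] /negPf kj]; rewrite dual_basis// kj.
have zN j : j \notin S -> dotr (normal v S - e *: z) (v j) < 1.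
  move=> jS; have := eP e j; rewrite lexx ltW//= (negPf jS) => /(_ isT).
  by rewrite dotrBl dotrZl; lra.
exists (normal v S - e *: z).
  move=> j; have [jS|/zN/ltW//] := boolP (j \in S).
  by rewrite dotrBl dotrZl zS// lerBlDr ler_wpDr ?normal_le1// mulr_ge0// ltW.
apply/setP => j; rewrite inE; have [jS|jS] := boolP (j \in S); last first.
  rewrite lt_eqF ?zN//; apply/esym/negbTE; apply: contra jS; exact: (subsetP GS).
rewrite dotrBl dotrZl zS//; move: jS; rewrite -(normal_eq1 _ SF) => /eqP ->.
rewrite -subr_eq0 addrAC subrr add0r oppr_eq0 mulf_eq0 gt_eqF//=.
by rewrite pnatr_eq0; case: (j \in G).
Qed.

Lemma has_dim_face G : G \in faces v -> (0 < #|G|)%N -> has_dim (hull v G) #|G|.-1.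
Proof.
move=> GF; rewrite card_gt0 => /set0Pn[i iG]; have [w _ wG] := face_normal GF.
have /facesP[S SF GS] := GF.
rewrite -(dim_vspan_free (v := v) (c := D S)); last first.
  by move=> j k jG kG; apply: dual_basis => //; exact: (subsetP GS).
by apply: (has_dim_hull (w := w) iG) => j; rewrite -wG inE => /eqP.
Qed.

Lemma hull_faces_inj : {in faces v &, injective (hull v)}.
Proof.
have sub G G' : G' \in faces v -> hull v G = hull v G' -> G \subset G'.
  move=> G'F GG'; have [w wA wG'] := face_normal G'F; apply/subsetP => i iG.
  have : hull v (tight v w) (v i) by rewrite wG' -GG'; exact: hull_vertex.
  by rewrite -(hull_tight wA) -wG' inE => -[_ /= ->].
by move=> G G' GF G'F GG'; apply/eqP; rewrite eqEsubset !sub.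
Qed.

Lemma faces_of_dimE k : (k < d)%N ->
  faces_of_dim P k = [set hull v G | G in [set` faces_card v k.+1]]%classic.
Proof.
move=> kd; apply/seteqP; split=> [F [[c [b [cb FE]]] Fk]|_ [G /= + <-]]; last first.
  rewrite inE => /andP[GF /eqP Gk]; split; last first.
    by rewrite -[k]/(k.+1.-1) -Gk; apply: has_dim_face => //; rewrite Gk.
  have [w wA wG] := face_normal GF.
  exists w, 1; split; last by rewrite hull_tight// wG.
  by move=> x; apply: hull_le => i _; exact: wA.
have P0 : P 0 by exact: interior_subset P_int0.
have vP i : P (v i) by apply: hull_vertex; rewrite inE.
(* As 0 lies in P, the bound [b] is nonnegative. If it is 0, then [c] vanishes since 0 is interior,
   and the face is P itself, excluded by its dimension. Otherwise [c] is rescaled to the bound 1. *)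
have := cb 0 P0; rewrite dotr0r le_eqVlt => /predU1P[b0|b0].
  have c0 : c = 0.
    apply/eqP; apply: contraT => /pos_span[i]; rewrite ltNge.
    by have := cb _ (vP i); rewrite -b0 => ->.
  have FP : F = P by rewrite FE; apply/seteqP; split=> [x []//|x Px]; split=> //=; rewrite c0 dotr0l.
  by rewrite FP in Fk; move: kd; rewrite (has_dim_inj Fk P_dim) ltnn.
pose w := b^-1 *: c.
have wA : admissible v w by move=> i; rewrite dotrZl ler_pdivrMl// mulr1 cb.
have {}FE : F = hull v (tight v w).
  rewrite -hull_tight// FE; apply/seteqP; split=> x [Px /= xb]; split=> //=.
    by rewrite dotrZl xb mulVf// gt_eqF.
  by apply/eqP; rewrite -(inj_eq (mulfI (invr_neq0 (lt0r_neq0 b0)))) -dotrZl xb mulVf// gt_eqF.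
have wF : tight v w \in faces v by exact: extend_to_facet.
exists (tight v w) => //=; rewrite inE wF /=.
have w0 : (0 < #|tight v w|)%N.
  have [x] := has_dim_neq0 Fk; rewrite FE => -[a [_ aT a1 _]].
  rewrite card_gt0; apply: contra_eqN a1 => /eqP w0.
  by rewrite big1 1?eq_sym ?oner_eq0// => i _; rewrite aT// w0 inE.
rewrite FE in Fk; rewrite (has_dim_inj Fk (has_dim_face wF w0)).
by rewrite prednK.
Qed.

Lemma face_numE k : (k < d)%N -> face_num P k = #|faces_card v k.+1|.
Proof.
move=> kd; rewrite /face_num faces_of_dimE// card_fset_set_image//.
move=> G G'; rewrite !inE => /andP[GF _] /andP[G'F _]; apply: hull_faces_inj.
  by rewrite inE.
by rewrite inE.
Qed.

(** * Lattice points on the boundary of dilates *)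

(** The cones over the facets cover the space: apply [exists_facet_neg_part] to the empty face,
    which leaves no negative coordinate. *)
Lemma facet_cone x : exists2 S, S \in facets v & forall i, i \in S -> 0 <= dotr (D S i) x.
Proof.
have /facesP[S0 S0F _] : tight v 0 \in faces v.
  by apply: extend_to_facet => // i; rewrite dotr0l ler01.
have G0 : set0 \in faces v by apply/facesP; exists S0 => //; exact: sub0set.
have [S SF /andP[_]] := exists_facet_neg_part pos_span dual_basis x G0.
rewrite subset0 => /eqP neg0; exists S => // i iS; rewrite leNgt; apply/negP => xi.
by have := in_set0 i; rewrite -neg0 inE iS xi.
Qed.

Lemma dotr_normal S x : S \in facets v ->
  dotr (normal v S) x = \sum_(i in S) dotr (D S i) x.
Proof.
move=> SF; rewrite {1}(basis_expand dual_basis x SF) dotr_sumr.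
apply: eq_bigr => i; rewrite dotrZr -(normal_eq1 _ SF) => /eqP ->.
by rewrite mulr1.
Qed.

(** On the cone over [S], the normal of [S] is thus the gauge of P: each basis vector has value 1
    under it and at most 1 under [S']. *)
Lemma dotr_normal_le S S' x : S \in facets v -> S' \in facets v ->
  (forall i, i \in S -> 0 <= dotr (D S i) x) ->
  dotr (normal v S') x <= dotr (normal v S) x.
Proof.
move=> SF S'F x0; rewrite (dotr_normal x SF) {1}(basis_expand dual_basis x SF) dotr_sumr.
apply: ler_sum => i iS; rewrite dotrZr -[leRHS]mulr1.
by rewrite ler_wpM2l ?x0// normal_le1.
Qed.

Lemma dilate_le m S x : S \in facets v -> dilate m P x -> dotr (normal v S) x <= m%:R.
Proof.
move=> SF [y Py <-]; rewrite dotrZr -[leRHS]mulr1 ler_wpM2l//.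
by apply: hull_le Py => i _; exact: normal_le1.
Qed.

Lemma mem_dilate m S x : (0 < m)%N -> S \in facets v ->
    (forall i, i \in S -> 0 <= dotr (D S i) x) ->
  dotr (normal v S) x <= m%:R -> dilate m P x.
Proof.
move=> m0 SF x0 xm; have mR : 0 < m%:R :> R by rewrite ltr0n.
(* A convex representation of 0 absorbs the missing weight 1 - r. *)
have [z [z0 _ z1 zE]] : P 0 by exact: interior_subset P_int0.
exists (m%:R^-1 *: x); last by rewrite scalerA divff ?scale1r// gt_eqF.
pose r := m%:R^-1 * dotr (normal v S) x.
have r1 : 0 <= 1 - r by rewrite subr_ge0 ler_pdivrMl// mulr1.
exists (fun i => (if i \in S then m%:R^-1 * dotr (D S i) x else 0) + (1 - r) * z i); split.
- move=> i; rewrite addr_ge0// ?mulr_ge0//; case: ifP => // iS.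
  by rewrite mulr_ge0 ?x0// invr_ge0 ltW.
- by move=> i; rewrite inE.
- rewrite big_split/= -mulr_sumr z1 mulr1 -big_mkcond/= -mulr_sumr -dotr_normal//.
  by rewrite addrC subrK.
under [RHS]eq_bigr do rewrite scalerDl -scalerA.
rewrite big_split/= -scaler_sumr -zE scaler0 addr0 {1}(basis_expand dual_basis x SF).
rewrite scaler_sumr big_mkcond; apply: eq_bigr => i _.
by case: ifP => _; rewrite ?scale0r// scalerA.
Qed.

Lemma boundary_dilateP m x : (0 < m)%N -> boundary (dilate m P) x <->
  exists S, [/\ S \in facets v, forall i, i \in S -> 0 <= dotr (D S i) x &
    dotr (normal v S) x = m%:R].
Proof.
move=> m0; split=> [[xcl xint]|[S [SF x0 xm]]]; last first.
  split; first by apply: subset_closure; apply: (mem_dilate m0 SF); rewrite ?xm.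
  (* Moving [x] outwards along itself raises the normal of [S] above [m]. *)
  move=> xint; have [e e0 /(dilate_le SF)] := interior_segment x xint.
  rewrite dotrDr dotrZr xm gerDl leNgt mulr_gt0// ltr0n; exact.
have [S SF x0] := facet_cone x; exists S; split=> //.
apply/eqP; rewrite eq_le; apply/andP; split.
  pose H := [set y | dotr (normal v S) y <= m%:R]%classic.
  have /closure_id HE : closed H by exact: closed_halfspace.
  suff : H x by []; rewrite HE; apply: closure_subset xcl => y.
  exact: dilate_le.
rewrite leNgt; apply/negP => xm; apply: xint.
(* The normal of [S] is the largest at [x], so all facet normals stay below [m] nearby; each nearby
   point lies in some facet cone, hence in the dilate. *)
have : \forall y \near x, forall T : {set 'I_n}, T \in facets v -> dotr (normal v T) y < m%:R.
  apply: (@filter_forall _ {set 'I_n}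
    (fun T y => T \in facets v -> dotr (normal v T) y < m%:R) (nbhs x) _) => T.
  have [TF|_] := boolP (T \in facets v); last by apply: filterE.
  have /open_nbhs_nbhs : open_nbhs x [set y | dotr (normal v T) y < m%:R]%classic.
    split; first exact: open_halfspace.
    exact: le_lt_trans (dotr_normal_le SF TF x0) xm.
  by apply: filterS.
apply: filterS => y ym; have [T TF y0] := facet_cone y.
by apply: (mem_dilate m0 TF) => //; rewrite ltW// ym.
Qed.

(** For 1 <= #|G| <= m <= 2 the natural-number quotient is exact, and this is the only positive
    integral combination of the vertices of [G] with coefficient sum [m]. *)
Definition face_point m G : 'rV[R]_d := (m %/ #|G|)%:R *: \sum_(i in G) v i.

Lemma face_point_coord m G S i : S \in facets v -> G \subset S -> i \in S ->
  dotr (D S i) (face_point m G) = if i \in G then (m %/ #|G|)%:R else 0.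
Proof.
move=> SF GS iS; rewrite dotrZr dotr_sumr; case: ifP => iG.
  rewrite (bigD1 i)//= dual_basis// eqxx big1 ?addr0 ?mulr1// => j /andP[jG /negPf ji].
  by rewrite dual_basis ?(subsetP GS)// eq_sym ji.
rewrite big1 ?mulr0// => j jG; rewrite dual_basis// ?(subsetP GS)//.
have /negPf -> // : i != j by apply: contraTneq jG => <-; rewrite iG.
Qed.

Lemma face_point_normal m G S : S \in facets v -> (0 < #|G|)%N -> (#|G| %| m)%N ->
  (forall i, i \in G -> dotr (normal v S) (v i) = 1) ->
  dotr (normal v S) (face_point m G) = m%:R.
Proof.
move=> SF G0 Gm vG; rewrite dotrZr dotr_sumr (eq_bigr (fun=> 1)) => [|i /vG ->//].
by rewrite sumr_const -natrM divnK.
Qed.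

Definition nonempty_faces m : {set {set 'I_n}} :=
  [set G : {set _} in faces v | (0 < #|G|)%N && (#|G| <= m)%N].

(** If the points of [G] and [G'] agree, both have value [m] under the normal of a facet [S]
    containing [G]. As the normal is at most 1 on generators, this puts [G'] inside [S], and the
    coordinates in the basis of [S] show the supports. *)
Lemma face_point_inj m : (0 < m)%N -> (m <= 2)%N ->
  {in nonempty_faces m &, injective (face_point m)}.
Proof.
move=> m0 m2.
have sub G G' : G \in nonempty_faces m -> G' \in nonempty_faces m ->
    face_point m G = face_point m G' -> G' \subset G.
  rewrite inE => /andP[/facesP[S SF GS] /andP[G0 Gm]].
  rewrite inE => /andP[/facesP[S' S'F GS'] /andP[G'0 G'm]] GG'.
  have G'dvd := dvdn_le2 m2 G'0 G'm; have Gdvd := dvdn_le2 m2 G0 Gm.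
  have q0 : 0 < (m %/ #|G'|)%:R :> R by rewrite ltr0n divn_gt0.
  have G'S : G' \subset S.
    have : dotr (normal v S) (face_point m G') = m%:R.
      rewrite -GG' face_point_normal// => i /(subsetP GS).
      by rewrite -(normal_eq1 _ SF) => /eqP.
    rewrite dotrZr dotr_sumr -[in RHS](divnK G'dvd) natrM => /(mulfI (lt0r_neq0 q0)) GE.
    have /psumr_eq0P z : \sum_(i in G') (1 - dotr (normal v S) (v i)) = 0.
      by rewrite sumrB sumr_const GE subrr.
    apply/subsetP => i iG'; rewrite -(normal_eq1 _ SF) eq_sym -subr_eq0.
    by rewrite z// => j _; rewrite subr_ge0 normal_le1.
  apply/subsetP => i iG'; have iS := subsetP G'S i iG'.
  apply: contraT => iG; have := face_point_coord m SF GS iS.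
  by rewrite GG' face_point_coord// iG' (negPf iG) => /eqP; rewrite gt_eqF.
by move=> G G' Gm G'm GG'; apply/eqP; rewrite eqEsubset !sub.
Qed.

Lemma boundary_lattice m : (0 < m)%N -> (m <= 2)%N ->
  (boundary (dilate m P) `&` @lattice R d)%classic =
  [set face_point m G | G in [set` nonempty_faces m]]%classic.
Proof.
move=> m0 m2; apply/seteqP; split=> [x [/(boundary_dilateP _ m0)[S [SF x0 xm]] xlat]|].
  (* [G] is the support of [x]: its coordinates there are integers at least 1 with sum [m]. *)
  pose a i := dotr (D S i) x; pose G := [set i in S | a i != 0].
  have GS : G \subset S by apply/subsetP => i; rewrite inE => /andP[].
  have aG : \sum_(i in G) a i = m%:R.
    rewrite -xm dotr_normal// [RHS](bigID (fun i => a i == 0))/= [X in _ = X + _]big1 ?add0r; last first.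
      by move=> i /andP[_ /eqP].
    by apply: eq_bigl => i; rewrite inE.
  have a1 i : i \in G -> 1 <= a i.
    rewrite inE => /andP[iS ai]; rewrite int_gt0_ge1//; first exact: D_int.
    by rewrite lt_neqAle eq_sym ai x0.
  have Gm : (#|G| <= m)%N.
    by rewrite -(ler_nat R) -aG -sumr_const ler_sum.
  have G0 : (0 < #|G|)%N.
    rewrite lt0n cards_eq0; apply: contraTneq m0 => G0.
    by move/eqP: aG; rewrite G0 big_set0 eq_sym pnatr_eq0 => /eqP ->.
  (* As m <= 2, either [G] has one element, with coefficient [m], or it has [m] elements, all with
     coefficient 1. *)
  have aE i : i \in G -> a i = (m %/ #|G|)%:R.
    move=> iG; have [Gm1|Gm1] := eqVneq #|G| 1%N.
      move/eqP/cards1P: Gm1 aG => [j GE]; move: iG; rewrite GE inE => /eqP ->.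
      by rewrite big_set1 cards1 divn1.
    have GmE : #|G| = m by clear -G0 Gm Gm1 m2; lia.
    rewrite GmE divnn m0.
    have /psumr_eq0P z : \sum_(j in G) (a j - 1) = 0.
      by rewrite sumrB sumr_const aG GmE subrr.
    by apply/eqP; rewrite -subr_eq0 z// => j jG; rewrite subr_ge0 a1.
  exists G; first by rewrite /= inE G0 Gm !andbT; apply/facesP; exists S.
  rewrite (basis_expand dual_basis x SF) [RHS](bigID [in G])/= [X in _ + X]big1 ?addr0.
    rewrite /face_point scaler_sumr [RHS](eq_bigl [in G]) => [|i]; last first.
      by apply: andb_idl => /(subsetP GS).
    by apply: eq_bigr => i iG; rewrite -/(a i) aE.
  move=> i /andP[iS]; rewrite inE iS/= negbK => /eqP ai.
  by rewrite -/(a i) ai scale0r.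
move=> _ [G /= + <-]; rewrite inE => /andP[/facesP[S SF GS] /andP[G0 Gm]]; split.
  apply/boundary_dilateP => //; exists S; split=> // [i iS|].
    by rewrite face_point_coord//; case: ifP.
  rewrite face_point_normal ?dvdn_le2// => i /(subsetP GS).
  by rewrite -(normal_eq1 _ SF) => /eqP.
apply/mxOverP => i j; rewrite mxE rpredM ?natr_int// summxE rpred_sum// => k _.
by have /mxOverP := v_lattice k.
Qed.

Lemma boundary_pointsE m : (0 < m)%N -> (m <= 2)%N ->
  boundary_points P m = #|nonempty_faces m|.
Proof.
move=> m0 m2; rewrite /boundary_points boundary_lattice// card_fset_set_image//.
exact: face_point_inj.
Qed.

End Smooth.

(** * Face numbers from boundary points in dimensions 3, 4 and 5 *)

(** Here [g k] counts the faces with [k] vertices, so its index is the dimension plus one. *)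
Lemma smooth_polytope_counts (R : realType) (d : nat) (P : set 'rV[R]_d) :
  (0 < d)%N -> smooth_polytope P -> exists g h : nat -> nat,
  [/\ g 0 = 1, boundary_points P 1 = g 1, boundary_points P 2 = g 1 + g 2,
    forall k, k < d -> face_num P k = g k.+1 &
    forall k, k <= d -> g k = \sum_(p < d.+1) h p * 'C(p, d - k) /\
      g k = \sum_(p < d.+1) h p * 'C(d - p, d - k)]%N.
Proof.
move=> d0 [[s [slat ->]] Pdim Pint Pfacets].
(* Duplicates are removed to make the enumeration injective. *)
pose v (i : 'I_(size (undup s))) := (undup s)`_i.
have v_inj : injective v.
  by move=> i j /eqP; rewrite nth_uniq ?undup_uniq// => /eqP/val_inj.
have vE : [set` s]%classic = range v.
  apply/seteqP; split=> [x /= |_ [i _ <-]] /=; last by rewrite -mem_undup mem_nth.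
  by rewrite -mem_undup => /(nthP 0)[i ilt <-]; exists (Ordinal ilt).
have v_lat i : lattice (v i) by apply: slat; rewrite /= -mem_undup mem_nth.
move: Pdim Pint Pfacets; rewrite vE conv_hull_range => Pdim Pint Pfacets.
have span := positively_spanning_of_interior Pint.
have [D [Dv Dint]] := facet_dual_basis v_inj v_lat d0 Pfacets.
have cardS := card_facet_smooth v_inj v_lat d0 Pfacets.
have [h hP] := dehn_sommerville span Dv cardS.
have bE m : (0 < m <= 2)%N -> boundary_points (hull v [set: 'I__]) m = #|nonempty_faces v m|.
  by case/andP=> m0 m2; rewrite (boundary_pointsE v_lat Pint Dv Dint).
exists (fun k => #|faces_card v k|), h; split=> //.
- exact: card_faces0 span.
- rewrite bE//; apply: eq_card => G; rewrite !inE; congr (_ && _).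
  by case: #|G| => [|[]].
- rewrite bE// -cardsUI [X in (_ + X)%N](_ : _ = 0%N) ?addn0.
    apply: eq_card => G; rewrite !inE -andb_orr; congr (_ && _).
    by case: #|G| => [|[|[]]].
  apply: eq_card0 => G; rewrite !inE; apply/negP => /andP[/andP[_ /eqP ->]].
  by rewrite andbF.
by move=> k kd; rewrite (face_numE Pdim Pint Dv).
Qed.

Theorem theorem4p2 (R : realType) (d : nat) (P : set 'rV[R]_d)
    (smoothP : smooth_polytope P) :
  let b (m : nat) : int := Posz (boundary_points P m) in
  let f : seq int := [seq Posz k | k <- f_vector P] in
  [/\ d = 3%N -> f = [:: b 1%N; 3 * b 1%N - 6; 2 * b 1%N - 4],
      d = 4%N -> f = [:: b 1%N; b 2%N - b 1%N; 2 * b 2%N - 4 * b 1%N; b 2%N - 2 * b 1%N]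
    & d = 5%N -> f = [:: b 1%N; b 2%N - b 1%N; 4 * b 2%N - 14 * b 1%N + 20;
                         5 * b 2%N - 20 * b 1%N + 30; 2 * b 2%N - 8 * b 1%N + 12]].
Proof.
move=> b f.
have [d0|d0] := posnP d; first by split=> dE; move: d0; rewrite dE.
have [g [h [g0 b1 b2 fE gE]]] := smooth_polytope_counts d0 smoothP.
(* With the binomials evaluated, each [g k] has two linear expressions in the numbers [h p];
   eliminating these with [g 0 = 1] gives the entries of the f-vector. *)
pose binomE := (addn0, add1n, subSS, subn0, bin0, bin0n, binS).
split=> dE; subst d; rewrite {}/f {}/b ?b1 ?b2 /f_vector /= !fE//.
- move: (gE 0%N isT) (gE 1%N isT) (gE 2%N isT) (gE 3%N isT).
  rewrite g0 !big_ord_recl !big_ord0 /= /bump /= !binomE /=.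
  by move=> *; do ?congr cons; lia.
- move: (gE 0%N isT) (gE 1%N isT) (gE 2%N isT) (gE 3%N isT) (gE 4%N isT).
  rewrite g0 !big_ord_recl !big_ord0 /= /bump /= !binomE /=.
  by move=> *; do ?congr cons; lia.
- move: (gE 0%N isT) (gE 1%N isT) (gE 2%N isT) (gE 3%N isT) (gE 4%N isT) (gE 5%N isT).
  rewrite g0 !big_ord_recl !big_ord0 /= /bump /= !binomE /=.
  by move=> *; do ?congr cons; lia.
Qed.
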